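(* If $D$ is a digraph whose underlying graph is a tree, then ${\rm ndi}(D)\le\Delta^*(D)+1$.
   Context: All digraphs are finite, without loops and without multiple arcs (opposite arcs allowed). The underlying graph of $D$ is the simple undirected graph obtained by replacing each arc $uv$ (or each pair of arcs $uv,vu$) by the edge $uv$. $\Delta^*(D)$ is the maximum of the maximum outdegree and the maximum indegree of $D$. A (proper) $k$-arc-colouring of $D$ is a map $\gamma$ from $A(D)$ to a set of $k$ colours such that arcs with the same head get distinct colours and arcs with the same tail get distinct colours. $S_\gamma^+(u)$, $S_\gamma^-(u)$ are the sets of colours on arcs with tail $u$, resp. head $u$. $\gamma$ is neighbour-distinguishing if for every arc $uv$, $(S_\gamma^+(u),S_\gamma^-(u))\neq(S_\gamma^+(v),S_\gamma^-(v))$ as ordered pairs. ${\rm ndi}(D)$ is the minimum number of colours of a neighbour-distinguishing arc-colouring of $D$. *)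

(* Defs.v *)
From HB Require Import structures.
From mathcomp Require Import all_boot.

Set Implicit Arguments.
Unset Strict Implicit.
Unset Printing Implicit Defensive.

(* Representing the arcs by a relation excludes multiple arcs while allowing
   opposite ones. *)
Record digraph := Digraph {
  vertex :> finType;
  adj : rel vertex;
  adj_irr : irreflexive adj
}.

Definition arcs (D : digraph) : finType := {a : D * D | adj a.1 a.2}.

Definition tail (D : digraph) (a : arcs D) : D := (val a).1.
Definition head (D : digraph) (a : arcs D) : D := (val a).2.

Definition outdeg (D : digraph) (u : D) : nat := #|[set a : arcs D | tail a == u]|.
Definition indeg (D : digraph) (u : D) : nat := #|[set a : arcs D | head a == u]|.

Definition Delta_star (D : digraph) : nat :=
  maxn (\max_(u : D) outdeg u) (\max_(u : D) indeg u).

Definition underlying (D : digraph) : rel D :=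
  [rel u v | adj u v || adj v u].

(* [e] is the adjacency relation of a simple undirected graph. The bound on the
   size discards the closed walks [:: u; v] that traverse one edge back and
   forth, which [ucycle] accepts but which are not cycles of the graph. *)
Definition is_tree (T : finType) (e : rel T) : Prop :=
  [/\ 0 < #|T|,
      forall u v : T, connect e u v
    & forall p : seq T, ucycle e p -> size p < 3].

Section Colouring.
Variables (D : digraph) (C : finType) (g : {ffun arcs D -> C}).

Definition proper_colouring : bool :=
  [forall a, forall b,
     (a != b) && ((head a == head b) || (tail a == tail b)) ==> (g a != g b)].

Definition Sout (u : D) : {set C} := [set g a | a : arcs D & tail a == u].
Definition Sin (u : D) : {set C} := [set g a | a : arcs D & head a == u].

Definition neighbour_distinguishing : bool :=
  [forall a : arcs D,
     (Sout (tail a), Sin (tail a)) != (Sout (head a), Sin (head a))].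

End Colouring.

Definition nd_colourable (D : digraph) (k : nat) : bool :=
  [exists g : {ffun arcs D -> 'I_k},
     proper_colouring g && neighbour_distinguishing g].

Lemma nd_colourable_exists (D : digraph) : exists k, nd_colourable D k.
Proof.
exists #|arcs D|; apply/existsP; exists [ffun a => enum_rank a].
apply/andP; split.
  apply/forallP=> a; apply/forallP=> b; apply/implyP=> /andP[ab _].
  by rewrite !ffunE (inj_eq enum_rank_inj).
apply/forallP=> a; apply/eqP=> -[/setP/(_ (enum_rank a)) eqS _].
have : enum_rank a \in Sout [ffun b : arcs D => enum_rank b] (tail a).
  by apply/imsetP; exists a; rewrite ?inE ?ffunE.
rewrite eqS => /imsetP[b]; rewrite inE ffunE => /eqP tb /enum_rank_inj ab.
have := valP a; rewrite -/(tail a) -/(head a) -tb -ab.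
by rewrite adj_irr.
Qed.

Definition ndi (D : digraph) : nat := ex_minn (nd_colourable_exists D).

(* Main.v *)
(** Root the tree and colour the arcs from the root downwards. When a vertex [u]
    with parent [p] is reached, only the arcs between [u] and [p] are coloured,
    and the colour sets of [p] are known. If [u] has a child, the spare colour
    leaves at least two choices for one of its two colour sets, so the pair of
    [p] can be avoided. If [u] is a leaf, the pairs of [u] and [p] can only
    agree when [u] is the only neighbour of [p], so that [p] is the root and its
    two colour sets are equal and nonempty. The colouring of the arcs at the
    root is chosen so that this does not happen. *)
From HB Require Import structures.
From mathcomp Require Import all_boot.
Require Import Defs.

Set Implicit Arguments.
Unset Strict Implicit.
Unset Printing Implicit Defensive.

(** * Extending injections while avoiding a prescribed image *)

Lemma injection_into (T U : finType) (B : {set T}) (C : {set U}) (g : T -> U) :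
  #|B| <= #|C| ->
  exists f : T -> U, [/\ {in B &, injective f},
    forall x, x \in B -> f x \in C & forall x, x \notin B -> f x = g x].
Proof.
move=> leBC.
have idx x : x \in B -> index x (enum B) < size (enum C).
  by move=> xB; rewrite -cardE (leq_trans _ leBC)// cardE index_mem mem_enum.
(* The default [g x] is never reached on [B]; it spares the assumption that [U] is inhabited. *)
exists (fun x => if x \in B then nth (g x) (enum C) (index x (enum B)) else g x).
split=> [x y xB yB|x xB|x /negbTE->//]; last first.
  by rewrite xB -mem_enum mem_nth ?idx.
rewrite xB yB (set_nth_default (g y)) ?idx// => /eqP.
rewrite nth_uniq ?idx ?enum_uniq// => /eqP /(congr1 (nth x (enum B))).
by rewrite !nth_index ?mem_enum.
Qed.

(** Since [g] is injective on [F] and [U] is larger than [A], more than [#|A :\: F|] values lie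
    outside [g @: F]. This spare value lets the image be steered away from [S]. In use, [A] is the
    set of arcs leaving (or entering) a vertex and [F] its coloured part. *)
Lemma extend_injection (T U : finType) (A F : {set T}) (g : T -> U)
    (S : {set U}) :
  F \subset A -> #|A| < #|U| -> {in F &, injective g} ->
  exists h : T -> U, [/\ {in A &, injective h},
    forall x, x \notin A :\: F -> h x = g x & A != F -> h @: A != S].
Proof.
move=> sFA ltAU injg.
pose C := ~: (g @: F).
have ltC : #|A :\: F| < #|C|.
  rewrite cardsD (setIidPr sFA) [#|C|]cardsCs setCK (card_in_imset injg).
  by rewrite ltn_sub2r// (leq_ltn_trans (subset_leq_card sFA)).
have inj_ext (h : T -> U) : {in A :\: F &, injective h} ->
    (forall x, x \in A :\: F -> h x \in C) ->
    (forall x, x \notin A :\: F -> h x = g x) -> {in A &, injective h}.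
  move=> injh hC hg x y xA yA.
  have off z : z \in F -> h z = g z by move=> zF; rewrite hg// inE zF.
  have disj z t : z \in F -> t \in A -> t \notin F -> h t <> g z.
    move=> zF tA tF e; have /hC : t \in A :\: F by rewrite inE tF.
    by rewrite inE e imset_f.
  have [xF|xF] := boolP (x \in F); have [yF|yF] := boolP (y \in F).
  - by rewrite (off x)// (off y)//; apply: injg.
  - by rewrite (off x)// => /esym/(disj _ _ xF yA yF).
  - by rewrite (off y)// => /(disj _ _ yF xA xF).
  - by apply: injh; rewrite inE ?xF ?yF.
(* Either some available colour lies in [S], and it is left out, or every
   available colour lies outside [S]. *)
have [CS0|[c /setIP[cC cS]]] := set_0Vmem (C :&: S).
  have [h [injh hC hg]] := injection_into g (ltnW ltC).
  exists h; split=> //; first exact: inj_ext.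
  move=> neAF; have [x xAF] : exists x, x \in A :\: F.
    apply/set0Pn; apply: contraNneq neAF => /eqP; rewrite setD_eq0 => sAF.
    by rewrite eqEsubset sAF.
  apply/eqP=> hAS; have : h x \in C :&: S.
    by rewrite inE hC// -hAS imset_f//; case/setDP: xAF.
  by rewrite CS0 inE.
have leC : #|A :\: F| <= #|C :\ c| by rewrite -ltnS (cardsD1 c C) cC in ltC *.
have [h [injh hC hg]] := injection_into g leC.
exists h; split=> //.
  by apply: inj_ext => // x /hC /setD1P[].
(* [c] is missed by [h]: it was withheld from [A :\: F] and lies outside [g @: F]. *)
move=> _; apply/eqP=> hAS; move: cS; rewrite -hAS => /imsetP[x xA cE].
have [xAF|xAF] := boolP (x \in A :\: F).
  by move/hC: xAF; rewrite -cE !inE eqxx.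
have xF : x \in F by move: xAF; rewrite inE xA andbT negbK.
by move: cC; rewrite cE hg// inE imset_f.
Qed.

(** * Growing a connected vertex set in a tree *)

Definition within (T : finType) (e : rel T) (X : {set T}) : rel T :=
  [rel x y | [&& e x y, x \in X & y \in X]].

(** Distinct [p] and [q] would be joined by a simple path inside [X], which [u] closes into a cycle
    with at least three vertices. *)
Lemma tree_unique_neighbour (T : finType) (e : rel T) (X : {set T}) (u p q : T) :
  symmetric e -> is_tree e ->
  {in X &, forall x y, connect (within e X) x y} ->
  u \notin X -> p \in X -> q \in X -> e u p -> e u q -> p = q.
Proof.
move=> sym_e [_ _ acyc] conX uX pX qX eup euq; apply/eqP/negPn/negP=> npq.
have /connectP[s0 path_s0 last_s0] := conX _ _ pX qX.
case/shortenP: path_s0 last_s0 => s path_s uniq_s _ last_s.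
have path_e : path e p s by apply: sub_path path_s => x y /and3P[].
have /allP sX : all [in X] s.
  by elim: s p {last_s path_e uniq_s pX npq eup} path_s => //= y s IH p
    /andP[/and3P[_ _ ->] /IH].
have /acyc : ucycle e [:: u, p & s].
  have /= {}uniq_s := uniq_s.
  rewrite /ucycle /= eup rcons_path path_e -last_s sym_e euq uniq_s andbT /=.
  rewrite inE negb_or andbT (contraNneq _ uX) => [/=|->//].
  by apply: contra uX => /sX.
by case: s last_s {path_s uniq_s path_e sX} => //= qE; rewrite qE eqxx in npq.
Qed.

Lemma exists_crossing_edge (T : finType) (e : rel T) (X : {set T}) (r v : T) :
  symmetric e -> connect e r v -> r \in X -> v \notin X ->
  exists u p, [/\ u \notin X, p \in X & e u p].
Proof.
move=> sym_e /connectP[s path_s ->].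
elim: s r path_s => /= [r _ ->//|y s IH r /andP[ery path_s] rX lX].
have [yX|yX] := boolP (y \in X); first exact: IH lX.
by exists y, r; rewrite sym_e.
Qed.

Lemma connected_setU1 (T : finType) (e : rel T) (X : {set T}) (u p : T) :
  symmetric e -> {in X &, forall x y, connect (within e X) x y} ->
  p \in X -> e u p ->
  {in u |: X &, forall x y, connect (within e (u |: X)) x y}.
Proof.
move=> sym_e conX pX eup.
have sym_w : connect_sym (within e (u |: X)).
  apply: sym_connect_sym => x y.
  by rewrite /within /= sym_e [(x \in _) && _]andbC.
suff to_p x : x \in u |: X -> connect (within e (u |: X)) x p.
  move=> x y /to_p xp /to_p yp; apply: connect_trans xp _.
  by rewrite sym_w.
case/setU1P=> [->|xX].
  by apply: connect1; rewrite /within /= eup !inE eqxx pX orbT.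
apply: connect_sub (conX _ _ xX pX) => y z /and3P[eyz yX zX].
by apply: connect1; rewrite /within /= eyz !inE yX zX !orbT.
Qed.

(** * Colourings that are good on part of the tree *)

Section Downward.
Variables (D : digraph) (k : nat).
Implicit Types (r u v p : D) (a b : arcs D) (X : {set D}).
Implicit Types (g : {ffun arcs D -> 'I_k}).

Let e := @underlying D.
Let connected X := {in X &, forall x y, connect (within e X) x y}.

Definition out_arcs u : {set arcs D} := [set a | tail a == u].
Definition in_arcs u : {set arcs D} := [set a | head a == u].

Lemma SoutE g u : Sout g u = g @: out_arcs u.
Proof.
by apply/setP=> c; apply/imsetP/imsetP=> -[a]; rewrite ?inE => aP ->;
  exists a; rewrite ?inE.
Qed.

Lemma SinE g u : Sin g u = g @: in_arcs u.
Proof.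
by apply/setP=> c; apply/imsetP/imsetP=> -[a]; rewrite ?inE => aP ->;
  exists a; rewrite ?inE.
Qed.

Lemma underlying_sym : symmetric e.
Proof. by move=> u v; rewrite /e /underlying /= orbC. Qed.

Definition mk_arc u v (uv : adj u v) : arcs D := exist _ (u, v) uv.

Lemma arc_ext a b : tail a = tail b -> head a = head b -> a = b.
Proof.
by case: a b => -[? ?] ? [[? ?] ?] /= tE hE; apply: val_inj; congr pair.
Qed.

Lemma tail_neq_head a : tail a != head a.
Proof.
by apply/eqP=> ta; have := valP a; rewrite -/(tail a) -/(head a) ta adj_irr.
Qed.

Lemma underlying_arc a : e (tail a) (head a).
Proof. by rewrite /e /underlying /= /tail /head (valP a). Qed.

Definition pair_of g u := (Sout g u, Sin g u).

(* The last clause is needed only for two vertices joined by opposite arcs. *)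
Definition good X r g : Prop :=
  [/\ forall v, v \in X ->
        {in out_arcs v &, injective g} /\ {in in_arcs v &, injective g},
      forall a, tail a \in X -> head a \in X ->
        pair_of g (tail a) <> pair_of g (head a)
    & in_arcs r = set0 \/ Sout g r <> Sin g r].

(** Equal pairs would force [u] and [p] to be joined by opposite arcs and [p] to have no other arc.
    Connectedness of [X] then makes [p] the root, with equal colour sets, against the last clause of
    [good]. *)
Lemma leaf_distinguished X r g u p :
  connected X -> r \in X -> p \in X -> u \notin X -> good X r g -> e u p ->
  (forall a, tail a = u -> head a = p) -> (forall a, head a = u -> tail a = p) ->
  pair_of g u <> pair_of g p.
Proof.
move=> conX rX pX uX [inj _ rootP] eup outu inu [].
have [injo inji] := inj p pX.
rewrite !SoutE !SinE => eqo eqi.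
have mo a v : tail a = v -> a \in out_arcs v by rewrite inE => ->.
have mi a v : head a = v -> a \in in_arcs v by rewrite inE => ->.
(* The colour of an arc from [u] to [p] lies in [Sin g p], hence in [Sin g u], so some arc enters
   [u]. *)
have same_out a : tail a = u -> exists b, head b = u.
  move=> ta; have : g a \in g @: in_arcs p by apply/imset_f/mi/outu.
  by rewrite -eqi => /imsetP[b]; rewrite inE => /eqP; exists b.
have same_in a : head a = u -> exists b, tail b = u.
  move=> ta; have : g a \in g @: out_arcs p by apply/imset_f/mo/inu.
  by rewrite -eqo => /imsetP[b]; rewrite inE => /eqP; exists b.
have [[a ta] [b hb]] : (exists a, tail a = u) /\ (exists b, head b = u).
  case/orP: eup => uvP.
    have ex : exists a, tail a = u by exists (mk_arc uvP).
    by split=> //; case: ex => a /same_out.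
  have ex : exists a, head a = u by exists (mk_arc uvP).
  by split=> //; case: ex => a /same_in.
have [ha tb] := (outu a ta, inu b hb).
have Souts : g @: out_arcs u = [set g a].
  apply/setP=> c; rewrite inE; apply/imsetP/eqP=> [[d]|->]; last first.
    by exists a => //; apply: mo.
  rewrite inE => /eqP td ->; congr (g _).
  by apply: arc_ext; rewrite ?ta ?ha ?(outu d).
have Sins : g @: in_arcs u = [set g b].
  apply/setP=> c; rewrite inE; apply/imsetP/eqP=> [[d]|->]; last first.
    by exists b => //; apply: mi.
  rewrite inE => /eqP td ->; congr (g _).
  by apply: arc_ext; rewrite ?hb ?tb ?(inu d).
(* The colour set at [p] is the same singleton as at [u], and [g] is injective on the arcs leaving
   [p]. *)
have out_p d : tail d = p -> d = b.
  move=> td; apply: injo; rewrite ?mo//.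
  have /(imset_f g) := mo d p td; have /(imset_f g) := mo b p tb.
  by rewrite -eqo Souts !inE => /eqP-> /eqP.
have in_p d : head d = p -> d = a.
  move=> td; apply: inji; rewrite ?mi//.
  have /(imset_f g) := mi d p td; have /(imset_f g) := mi a p ha.
  by rewrite -eqi Sins !inE => /eqP-> /eqP.
have nbr_p v : e p v -> v = u.
  case/orP=> vP.
    have := out_p (mk_arc vP) erefl.
    by move/(congr1 (@head D)); rewrite hb.
  have := in_p (mk_arc vP) erefl.
  by move/(congr1 (@tail D)); rewrite ta.
(* The first step of a path from [p] to [r] inside [X] would lead to [u], which is outside [X]. *)
have pr : p = r.
  have /connectP[[|v s] /= path_s ->//] := conX _ _ pX rX.
  by case/andP: path_s => /and3P[/nbr_p -> _]; rewrite (negPf uX).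
case: rootP => [r0|]; first by have := mi a p ha; rewrite pr r0 inE.
apply; rewrite SoutE SinE -pr -eqo -eqi Souts Sins; congr [set _].
have /(imset_f g) := mi a p ha.
by rewrite -eqi Sins inE => /eqP.
Qed.

(** * Colouring the root, extending to a child, and induction *)

Hypothesis outdeg_lt : forall u, outdeg u < k.
Hypothesis indeg_lt : forall u, indeg u < k.

(** The outgoing arcs are coloured first; the incoming ones, if any, then avoid the resulting colour
    set. Without loops the two choices are independent. *)
Lemma good_root r : exists g, good [set r] r g.
Proof.
have k_gt0 : 0 < k by apply: leq_ltn_trans (outdeg_lt r).
pose c0 : arcs D -> 'I_k := fun=> Ordinal k_gt0.
have inj0 : {in set0 &, injective c0} by move=> ? ?; rewrite inE.
have [|h1 [inj1 _ _]] := extend_injection set0 (sub0set (out_arcs r)) _ inj0.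
  by rewrite card_ord outdeg_lt.
have [|h2 [inj2 _ ne2]] :=
    extend_injection (h1 @: out_arcs r) (sub0set (in_arcs r)) _ inj0.
  by rewrite card_ord indeg_lt.
pose g := [ffun a => if tail a == r then h1 a else h2 a].
have g1 : {in out_arcs r, g =1 h1} by move=> a; rewrite inE ffunE => ->.
have g2 : {in in_arcs r, g =1 h2}.
  move=> a; rewrite inE ffunE => /eqP <-.
  by rewrite (negPf (tail_neq_head a)).
exists g; split.
- move=> v /set1P->; split=> a b aP bP; first by rewrite !g1//; apply: inj1.
  by rewrite !g2//; apply: inj2.
- move=> a /set1P ta /set1P ha.
  by have := tail_neq_head a; rewrite ta ha eqxx.
- have [->|/ne2/eqP ne] := eqVneq (in_arcs r) set0; [by left|right].
  by rewrite SoutE SinE (eq_in_imset g1) (eq_in_imset g2) => /esym.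
Qed.

Lemma good_extend X r g u p :
  is_tree e -> connected X -> r \in X -> p \in X -> u \notin X -> e u p ->
  good X r g -> exists g', good (u |: X) r g'.
Proof.
move=> tree conX rX pX uX eup goodg; have [inj dist rootP] := goodg.
have nbr v : v \in X -> e u v -> v = p.
  move=> vX euv.
  exact: (tree_unique_neighbour underlying_sym tree conX uX vX pX).
have nbr_h a : tail a = u -> head a \in X -> head a = p.
  by move=> ta hX; apply: nbr => //; rewrite -ta underlying_arc.
have nbr_t a : head a = u -> tail a \in X -> tail a = p.
  by move=> ha tX; apply: nbr => //; rewrite underlying_sym -ha underlying_arc.
(* [Fo] and [Fi] collect the arcs between [u] and [p], which keep their colours. *)
pose Fo := [set a in out_arcs u | head a == p].
pose Fi := [set a in in_arcs u | tail a == p].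
have sFo : Fo \subset out_arcs u by apply/subsetP=> a; rewrite inE => /andP[].
have sFi : Fi \subset in_arcs u by apply/subsetP=> a; rewrite inE => /andP[].
have injFo : {in Fo &, injective g}.
  move=> a b; rewrite !inE => /andP[/eqP ta /eqP ha] /andP[/eqP tb /eqP hb] _.
  by apply: arc_ext; rewrite ?ta ?ha.
have injFi : {in Fi &, injective g}.
  move=> a b; rewrite !inE => /andP[/eqP ta /eqP ha] /andP[/eqP tb /eqP hb] _.
  by apply: arc_ext; rewrite ?ta ?ha.
have [|h1 [inj1 off1 ne1]] := extend_injection (Sout g p) sFo _ injFo.
  by rewrite card_ord outdeg_lt.
have [|h2 [inj2 off2 ne2]] := extend_injection (Sin g p) sFi _ injFi.
  by rewrite card_ord indeg_lt.
pose g' := [ffun a => if tail a == u then h1 a else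
                      if head a == u then h2 a else g a].
have g1 : {in out_arcs u, g' =1 h1} by move=> a; rewrite inE ffunE => ->.
have g2 : {in in_arcs u, g' =1 h2}.
  move=> a; rewrite inE ffunE => /eqP <-.
  by rewrite (negPf (tail_neq_head a)) eqxx.
(* An arc between [u] and [X] has its other end at [p], so it lies in [Fo] or [Fi], where [h1] and
   [h2] agree with [g]. *)
have old a : (tail a \in X) || (head a \in X) -> g' a = g a.
  move=> aX; rewrite ffunE; case: eqP => [ta|_].
    rewrite off1// !inE ta eqxx /= andbT negbK; apply/eqP/nbr_h => //.
    by move: aX; rewrite ta (negPf uX).
  case: eqP => [ha|//].
  rewrite off2// !inE ha eqxx /= andbT negbK; apply/eqP/nbr_t => //.
  by move: aX; rewrite ha (negPf uX) orbF.
have oldo v : v \in X -> {in out_arcs v, g' =1 g}.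
  by move=> vX a; rewrite inE => /eqP ta; rewrite old// ta vX.
have oldi v : v \in X -> {in in_arcs v, g' =1 g}.
  by move=> vX a; rewrite inE => /eqP ta; rewrite old// ta vX orbT.
have oldS v : v \in X -> pair_of g' v = pair_of g v.
  move=> vX; rewrite /pair_of !SoutE !SinE.
  by rewrite (eq_in_imset (oldo v vX)) (eq_in_imset (oldi v vX)).
have injg' v : v \in u |: X ->
    {in out_arcs v &, injective g'} /\ {in in_arcs v &, injective g'}.
  case/setU1P=> [->|vX].
    split=> a b aP bP; first by rewrite !g1//; apply: inj1.
    by rewrite !g2//; apply: inj2.
  have [io ii] := inj v vX.
  split=> a b aP bP; first by rewrite !(oldo v vX)//; apply: io.
  by rewrite !(oldi v vX)//; apply: ii.
have rootP' : in_arcs r = set0 \/ Sout g' r <> Sin g' r.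
  by have [-> ->] := oldS r rX.
have up_dist : pair_of g' u <> pair_of g' p.
  (* A newly coloured arc leaving or entering [u] separates the corresponding colour sets; with
     neither, [u] is a leaf. *)
  have [Eo|/ne1 neo] := eqVneq (out_arcs u) Fo; last first.
    rewrite (oldS p pX) => -[]; rewrite SoutE (eq_in_imset g1) => /eqP.
    by rewrite (negPf neo).
  have [Ei|/ne2 nei] := eqVneq (in_arcs u) Fi; last first.
    rewrite (oldS p pX) => -[_]; rewrite SinE (eq_in_imset g2) => /eqP.
    by rewrite (negPf nei).
  apply: (leaf_distinguished (X := X) (r := r)) => //.
  - split=> // [v vX|a tX hX]; first by apply: injg'; rewrite inE vX orbT.
    by rewrite !oldS//; apply: dist.
  - move=> a ta; have : a \in out_arcs u by rewrite inE ta.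
    by rewrite Eo inE => /andP[_ /eqP].
  - move=> a ta; have : a \in in_arcs u by rewrite inE ta.
    by rewrite Ei inE => /andP[_ /eqP].
exists g'; split=> // a /setU1P[ta|tX] /setU1P[ha|hX].
- by have := tail_neq_head a; rewrite ta ha eqxx.
- by rewrite ta (nbr_h a ta hX).
- by rewrite ha (nbr_t a ha tX) => /esym.
- by rewrite !oldS//; apply: dist.
Qed.

Lemma good_everywhere : is_tree e -> exists r g, good [set: D] r g.
Proof.
move=> tree; have [/card_gt0P[r _] conD _] := tree; exists r.
suff [X [_ _ [g goodX] <-]] : exists X,
    [/\ r \in X, connected X, exists g, good X r g & X = setT] by exists g.
(* Induction on a bound for the number of vertices outside [X]; while one remains, some edge leaves
   [X]. *)
suff ext n X : #|~: X| <= n -> r \in X -> connected X ->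
    (exists g, good X r g) -> exists X,
    [/\ r \in X, connected X, exists g, good X r g & X = setT].
  apply: (ext _ [set r] (leqnn _)); rewrite ?inE//; last exact: good_root.
  by move=> x y /set1P-> /set1P->; apply: connect0.
elim: n X => [|n IH] X leX rX conX [g goodX].
  exists X; split=> //; first by exists g.
  by apply/setC_inj/eqP; rewrite setCT -cards_eq0 -leqn0.
have [|[v]] := set_0Vmem (~: X).
  by move=> X0; apply: (IH X) => //; [rewrite X0 cards0 | exists g].
rewrite inE => vX.
have [u [p [uX pX eup]]] := exists_crossing_edge underlying_sym (conD r v) rX vX.
apply: (IH (u |: X)).
- rewrite -ltnS (leq_trans _ leX)// proper_card// properEneq.
  rewrite setCS subsetUr andbT; apply: contraNneq uX => /setC_inj <-.
  exact: setU11.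
- by rewrite inE rX orbT.
- exact: connected_setU1 underlying_sym conX pX eup.
- exact: good_extend tree conX rX pX uX eup goodX.
Qed.

Lemma tree_nd_colourable : is_tree e -> nd_colourable D k.
Proof.
case/good_everywhere=> r [g [inj dist _]].
apply/existsP; exists g; apply/andP; split; last first.
  by apply/forallP=> a; apply/eqP; apply: dist; rewrite inE.
apply/forallP=> a; apply/forallP=> b; apply/implyP=> /andP[ab same].
apply: contra ab => /eqP gab; apply/eqP.
case/orP: same => /eqP E.
  by have [_] := inj (head b) (in_setT _); apply; rewrite // inE ?E.
by have [+ _] := inj (tail b) (in_setT _); apply; rewrite // inE ?E.
Qed.

End Downward.

Theorem theorem9 (D : digraph) (hD : is_tree (@underlying D)) :
  ndi D <= Delta_star D + 1.
Proof.
rewrite /ndi; case: ex_minnP => m _; apply.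
(* The extra colour makes the two degree bounds strict. *)
apply: tree_nd_colourable hD => u; rewrite addn1 ltnS leq_max.
  by rewrite (leq_bigmax u).
by rewrite (leq_bigmax u) orbT.
Qed.
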